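(* If $Z$ is a binarized MTS-MIV for $D$, i.e. for each $d\in\mathcal D$, $$\big(\mathrm{E}[Y_d\mid D\ge j]-\mathrm{E}[Y_d\mid D<j]\big)\big(\mathrm{E}[Y_d\mid Z\ge z]-\mathrm{E}[Y_d\mid Z<z]\big)\ge 0\quad\text{for all } j,z,$$ then the same direction of correlation condition holds: $$\mathrm{Cov}(Y_d,D)\,\mathrm{Cov}(Y_d,Z)\ge 0\quad\text{for each } d\in\mathcal D.$$
   Context: Setting: all random variables live on one probability space. $D$ is a discrete random variable (treatment) with values in $\mathcal D=\{1,2,\dots,T\}$; for each $d\in\mathcal D$, $Y_d$ is an integrable real random variable (potential outcome); $Z$ is a real random variable (imperfect instrument) with values in $\mathcal Z\subseteq\mathbb R$, which may be discrete, continuous or mixed. The covariances are assumed to be well defined ($Z$ and $Y_dZ$ integrable). The values $j,z$ range over those for which the conditioning events $\{D\ge j\},\{D<j\},\{Z\ge z\},\{Z<z\}$ have positive probability. *)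

(* Defs.v *)
From mathcomp Require Import all_boot all_order all_algebra.
From mathcomp Require Import all_classical all_reals all_analysis.
Import Order.TTheory GRing.Theory Num.Theory.
Import numFieldNormedType.Exports.
Set Implicit Arguments.
Unset Strict Implicit.
Unset Printing Implicit Defensive.
Local Open Scope classical_set_scope.
Local Open Scope ring_scope.

(* E[X | A], meaningful when X is P-integrable and P A > 0. *)
Definition cond_mean (disp : measure_display) (Omega : measurableType disp)
    (R : realType) (P : probability Omega R) (X : Omega -> R) (A : set Omega)
    : R :=
  (\int[P]_(w in A) X w) / fine (P A).

(* [ZZ] is the set of values of the instrument: the thresholds z range over ZZ,
   and the thresholds j over the treatment values 1, ..., T. *)
Definition binarized_MTS_MIV (disp : measure_display)
    (Omega : measurableType disp) (R : realType) (P : probability Omega R)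
    (T : nat) (D : Omega -> nat) (Y : nat -> Omega -> R)
    (ZZ : set R) (Z : Omega -> R) : Prop :=
  forall d : nat, (1 <= d <= T)%N ->
  forall (j : nat) (z : R), (1 <= j <= T)%N -> ZZ z ->
    (0 < P [set w | (j <= D w)%N])%E -> (0 < P [set w | (D w < j)%N])%E ->
    (0 < P [set w | (z <= Z w)%R])%E -> (0 < P [set w | (Z w < z)%R])%E ->
    0 <= (cond_mean P (Y d) [set w | (j <= D w)%N]
          - cond_mean P (Y d) [set w | (D w < j)%N])
       * (cond_mean P (Y d) [set w | z <= Z w]
          - cond_mean P (Y d) [set w | Z w < z]).

Definition same_direction_of_correlation (disp : measure_display)
    (Omega : measurableType disp) (R : realType) (P : probability Omega R)
    (T : nat) (D : Omega -> nat) (Y : nat -> Omega -> R) (Z : Omega -> R)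
    : Prop :=
  forall d : nat, (1 <= d <= T)%N ->
    (0 <= covariance P (Y d) (fun w => (D w)%:R) * covariance P (Y d) Z)%E.

(* Main.v *)
Require Import Defs.
From mathcomp Require Import all_boot all_order all_algebra.
From mathcomp Require Import all_classical all_reals all_analysis.
From mathcomp Require Import measurable_realfun ring lra.
Import Order.TTheory GRing.Theory Num.Theory.
Import numFieldNormedType.Exports.
Local Open Scope classical_set_scope.
Local Open Scope ring_scope.

(* Let W = Y_d - E[Y_d].  For an event A, E[Y_d | A] - E[Y_d | ~A] equals
   E[W 1_A] / (P(A) P(~A)), and E[W 1_A] = 0 when A is degenerate, so the
   hypothesis says E[W 1_{D >= j}] * E[W 1_{Z >= z}] >= 0 for all j and z.
   A variable V is a limit of positive combinations of the indicators
   1_{V >= t} plus constants (Hoeffding's formula), hence E[W V] >= 0 as soon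
   as E[W 1_{V >= t}] >= 0 for all t.  This is used first with E[W 1_{Z >= z}] W
   and V = D, then with E[W D] W and V = Z. *)

(** * Staircase approximation of real numbers *)

(* Rounds x down to the grid of mesh 1/n, truncated to [-n, n]; written as a
   sum of threshold indicators so that it can be integrated termwise. *)
Definition staircase (R : realType) (n : nat) (x : R) : R :=
  (\sum_(k < n * n.*2) \1_[set y | k.+1%:R / n%:R - n%:R <= y] x) / n%:R - n%:R.

(** The indicator of index [k] equals 1 exactly when [k] is below the integer part of [(x + n) * n],
    so the sum counts indices; for [x < -n] that integer part is 0 and no threshold is reached. *)
Lemma staircase_sum (R : realType) (n : nat) (x : R) : (0 < n)%N ->
  \sum_(k < n * n.*2) \1_[set y : R | k.+1%:R / n%:R - n%:R <= y] x
  = (minn (n * n.*2) (Num.truncn ((x + n%:R) * n%:R)))%:R :> R.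
Proof.
move=> n0; have n0R : 0 < n%:R :> R by rewrite ltr0n.
transitivity (\sum_(k < n * n.*2)
    (k < Num.truncn ((x + n%:R) * n%:R))%N%:R : R).
  apply: eq_bigr => k _; rewrite indicE; congr (nat_of_bool _)%:R.
  rewrite truncn_gt_nat -ler_pdivrMr// -lerBlDr.
  by apply/idP/idP => [/set_mem //|h]; exact/mem_set.
rewrite -natr_sum; congr (_%:R); move: (Num.truncn _) (_ * _)%N => m M.
elim: M => [|M IH]; first by rewrite big_ord0 min0n.
rewrite big_ord_recr/= IH; case: (ltnP M m) => h.
  by rewrite (minn_idPl h) addn1.
by rewrite (minn_idPr (leqW h)) addn0.
Qed.

(** On [[-n, n]] the cap [n * n.*2] has no effect, so the error is the fractional part of
    [(x + n) * n] divided by [n]. *)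
Lemma staircase_near (R : realType) (n : nat) (x : R) :
  (0 < n)%N -> `|x| <= n%:R -> `|x - staircase R n x| <= n%:R^-1.
Proof.
move=> n0; rewrite ler_norml => /andP[xl xr].
have n0R : 0 < n%:R :> R by rewrite ltr0n.
rewrite /staircase staircase_sum//.
set y := (x + n%:R) * n%:R.
have y0 : 0 <= y by rewrite mulr_ge0//; lra.
have yM : y <= (n * n.*2)%:R.
  rewrite natrM /y mulrC ler_pM2l// -addnn natrD; lra.
have /minn_idPr -> : (Num.truncn y <= n * n.*2)%N.
  by rewrite -(ler_nat R) (le_trans _ yM)// truncn_le.
have /andP[t1 t2] := truncn_itv y0.
have -> : x = y / n%:R - n%:R by rewrite /y mulfK ?gt_eqF// addrK.
rewrite (_ : _ - _ = (y - (Num.truncn y)%:R) / n%:R); last by ring.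
rewrite ger0_norm; last by rewrite divr_ge0// subr_ge0.
by rewrite ler_piMl ?invr_ge0//; rewrite -natr1 in t2; lra.
Qed.

(** This provides a dominating function uniform in [n]. Beyond [[-n, n]] it holds because the
    staircase itself takes values in [[-n, n]]. *)
Lemma staircase_norm_le (R : realType) (n : nat) (x : R) :
  (0 < n)%N -> `|staircase R n x| <= `|x| + 1.
Proof.
move=> n0; have n0R : 0 < n%:R :> R by rewrite ltr0n.
have [xn|xn] := leP `|x| n%:R.
  have := staircase_near R n x n0 xn.
  have : n%:R^-1 <= 1 :> R by rewrite invf_le1// ler1n.
  by have := ler_normB x (x - staircase R n x); rewrite subKr; lra.
rewrite /staircase staircase_sum//; set m := minn _ _.
have m0 : 0 <= m%:R / n%:R :> R by rewrite divr_ge0.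
have : m%:R / n%:R <= n%:R *+ 2 :> R.
  by rewrite ler_pdivrMr// mulrC -mulrnA -natrM ler_nat muln2 geq_minl.
by rewrite ler_norml => ?; lra.
Qed.

Lemma staircase_cvg (R : realType) (x : R) :
  staircase R n.+1 x @[n --> \oo] --> x.
Proof.
apply/cvgrPdist_le => e e0.
near=> n; apply: (@le_trans _ _ n.+1%:R^-1).
  apply: staircase_near => //; rewrite -natr1 ler_wpDr//.
  by near: n; exact: nbhs_infty_ger.
by apply/ltW; near: n; exact: (near_infty_natSinv_lt (PosNum e0)).
Unshelve. all: by end_near. Qed.

(** * Thresholds taken from a prescribed set *)

(* The infimum of the points of S above z need not belong to S, whence a
   sequence of thresholds rather than a single one. *)
Lemma threshold_approx (R : realType) (S : set R) (z : R) :
    (exists2 x, S x & z <= x) ->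
  exists u : nat -> R, (forall n, S (u n)) /\
    forall x, S x -> \forall n \near \oo, (u n <= x) = (z <= x).
Proof.
move=> [x0 Sx0 zx0]; pose S' := S `&` [set x | z <= x].
have S'inf : has_inf S'.
  by split; [exists x0|exists z => x []].
have [Si|Si] := pselect (S' (inf S')).
  exists (fun=> inf S'); split=> [_|x Sx]; first exact: Si.1.
  apply: nearW => _; apply/idP/idP => [|zx]; first exact/le_trans/Si.2.
  by apply: ge_inf; [exact: S'inf.2|].
have H n : exists u, S' u /\ u < inf S' + n.+1%:R^-1.
  have [|u] := @inf_adherent _ S' n.+1%:R^-1 _ S'inf; first by rewrite invr_gt0.
  by exists u.
have [u Hu] := choice H.
exists u; split=> [n|x Sx]; first exact: (Hu n).1.1.
have [zx|xz] := leP z x; last first.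
  apply: nearW => n; apply/negbTE; rewrite -ltNge (lt_le_trans xz)//.
  exact: (Hu n).1.2.
(* The infimum is not attained here, so [x] lies strictly above it and the terms of [u] eventually
   fall below [x]. *)
have ix : inf S' < x.
  rewrite lt_neqAle ge_inf ?andbT; [|exact: S'inf.2|by []].
  by apply/eqP => E; apply: Si; rewrite E.
have xi0 : 0 < x - inf S' by rewrite subr_gt0.
near=> n; apply/ltW/(lt_trans (Hu n).2); rewrite -ltrBrDl.
by near: n; exact: (near_infty_natSinv_lt (PosNum xi0)).
Unshelve. all: by end_near. Qed.

(** * Limits and finite sums of integrals *)

(** Dominated convergence, in the form used for both limits below: thresholds approaching a level,
    and staircases approaching the identity. *)
Lemma dominated_Rintegral_ge0 (disp : measure_display)
    (Omega : measurableType disp) (R : realType)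
    (mu : {measure set Omega -> \bar R}) (f_ : nat -> Omega -> R)
    (f g : Omega -> R) :
  (forall n, measurable_fun [set: Omega] (f_ n)) ->
  measurable_fun [set: Omega] f ->
  (forall w, f_ n w @[n --> \oo] --> f w) ->
  mu.-integrable [set: Omega] (EFin \o g) ->
  (forall n w, `|f_ n w| <= g w) ->
  (forall n, 0 <= \int[mu]_w f_ n w) -> 0 <= \int[mu]_w f w.
Proof.
move=> mf_ mf f_f ig f_g f_0.
have [||||/= ifo _ cv] := @dominated_convergence _ _ _ mu _ measurableT
   (fun n => EFin \o f_ n) (EFin \o f) (EFin \o g) _ _ _ ig _.
- by move=> n; exact/measurable_EFinP.
- exact/measurable_EFinP.
- by apply: aeW => w _; apply: cvg_EFin; [exact: nearW|exact: f_f].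
- by apply: aeW => w n _ /=; rewrite lee_fin.
have cvR : \int[mu]_w f_ n w @[n --> \oo] --> \int[mu]_w f w.
  apply: fine_cvg; rewrite fineK//; exact: integrable_fin_num.
rewrite -(cvg_lim _ cvR)//; apply: limr_ge; last exact: nearW.
by apply/cvg_ex; eexists; exact: cvR.
Qed.

Lemma integrable_EFin_sum (disp : measure_display)
    (Omega : measurableType disp) (R : realType)
    (mu : {measure set Omega -> \bar R}) (I : Type) (s : seq I)
    (f : I -> Omega -> R) :
  (forall i, mu.-integrable [set: Omega] (EFin \o f i)) ->
  mu.-integrable [set: Omega] (EFin \o (fun w => \sum_(i <- s) f i w)).
Proof.
move=> fi; rewrite (_ : _ \o _ = (fun w => \sum_(i <- s) (f i w)%:E)%E).
  by apply: integrable_sum => // i _; exact: fi.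
by apply/funext => w /=; rewrite sumEFin.
Qed.

Lemma integrable_EFinZl (disp : measure_display)
    (Omega : measurableType disp) (R : realType)
    (mu : {measure set Omega -> \bar R}) (r : R) (f : Omega -> R) :
  mu.-integrable [set: Omega] (EFin \o f) ->
  mu.-integrable [set: Omega] (EFin \o (fun w => r * f w)).
Proof. by move=> fi; apply: eq_integrable (integrableZl _ r fi). Qed.

Lemma Rintegral_sum (disp : measure_display)
    (Omega : measurableType disp) (R : realType)
    (mu : {measure set Omega -> \bar R}) (I : Type) (s : seq I)
    (f : I -> Omega -> R) :
  (forall i, mu.-integrable [set: Omega] (EFin \o f i)) ->
  \int[mu]_w (\sum_(i <- s) f i w) = \sum_(i <- s) \int[mu]_w f i w.
Proof.
move=> fi; elim: s => [|i s IH].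
  rewrite big_nil; under eq_Rintegral do rewrite big_nil.
  by rewrite Rintegral_cst// mul0r.
rewrite big_cons -IH -RintegralD//; last exact: integrable_EFin_sum.
by apply: eq_Rintegral => w _; rewrite big_cons.
Qed.

Lemma integrable_mul_indic (disp : measure_display)
    (Omega : measurableType disp) (R : realType)
    (mu : {measure set Omega -> \bar R}) (W : Omega -> R) (A : set Omega) :
  measurable A -> mu.-integrable [set: Omega] (EFin \o W) ->
  mu.-integrable [set: Omega] (EFin \o (fun w => W w * \1_A w)).
Proof.
move=> mA iW; rewrite (_ : _ \o _ = (EFin \o W) \_ A).
  by apply/integrable_restrict => //; rewrite setTI; exact: integrableS iW.
by apply/funext => w; rewrite epatch_indic.
Qed.

Lemma Rintegral_mul_indic (disp : measure_display)
    (Omega : measurableType disp) (R : realType)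
    (mu : {measure set Omega -> \bar R}) (W : Omega -> R) (A : set Omega) :
  \int[mu]_w (W w * \1_A w) = \int[mu]_(w in A) W w.
Proof. by rewrite [RHS]Rintegral_mkcond patch_indic. Qed.

(** * Contrasts of conditional means *)

(** Let [a], [b] be the integrals of [X] over [A] and its complement, of probabilities [p] and
    [q = 1 - p]. Then [a - p * (a + b) = q * a - p * b], and dividing by [p * q] gives
    [a / p - b / q]. *)
Lemma cond_mean_sub (disp : measure_display)
    (Omega : measurableType disp) (R : realType)
    (P : probability Omega R) (X : Omega -> R) (A : set Omega) :
  measurable A -> (0 < P A)%E -> (0 < P (~` A))%E ->
  P.-integrable [set: Omega] (EFin \o X) ->
  cond_mean P X A - cond_mean P X (~` A) =
  (\int[P]_(w in A) (X w - \int[P]_w X w)) / (fine (P A) * fine (P (~` A))).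
Proof.
move=> mA pA pC iX.
have mC := measurableC mA.
have iXS B : measurable B -> P.-integrable B (EFin \o X).
  by move=> mB; exact: integrableS iX.
rewrite RintegralB//; [|exact: iXS|]; last first.
  exact: finite_measure_integrable_cst.
rewrite Rintegral_cst// /cond_mean.
have -> : \int[P]_w X w = \int[P]_(w in A) X w + \int[P]_(w in ~` A) X w.
  rewrite -Rintegral_setU ?setUv//.
  by apply/disj_setPS; rewrite setICr.
have p0 : 0 < fine (P A) by rewrite fine_gt0// pA ltey_eq fin_num_measure.
have q0 : 0 < fine (P (~` A)) by rewrite fine_gt0// pC ltey_eq fin_num_measure.
have pq : fine (P A) = 1 - fine (P (~` A)).
  rewrite probability_setC// fineB// ?fin_num_measure//=; lra.
move: p0; rewrite pq => p0.
by field; rewrite !gt_eqF.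
Qed.

(** * From superlevel sets to correlations *)

Lemma measurable_superlevel (disp : measure_display)
    (Omega : measurableType disp) (R : realType) (Z : Omega -> R) (z : R) :
  measurable_fun [set: Omega] Z -> measurable [set w | z <= Z w].
Proof.
move=> mZ; rewrite -[X in measurable X]setTI.
exact: measurable_fun_le.
Qed.

(** If no point of [S] is at or above [z], the superlevel set is empty. Otherwise it is approached
    by superlevel sets with thresholds in [S], the integrands being dominated by [|W|]. *)
Lemma superlevel_integral_ge0 (disp : measure_display)
    (Omega : measurableType disp) (R : realType)
    (mu : {measure set Omega -> \bar R}) (W Z : Omega -> R) (S : set R) :
  mu.-integrable [set: Omega] (EFin \o W) ->
  measurable_fun [set: Omega] Z ->
  (forall w, S (Z w)) ->
  (forall z, S z -> 0 <= \int[mu]_(w in [set w | z <= Z w]) W w) ->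
  forall z, 0 <= \int[mu]_(w in [set w | z <= Z w]) W w.
Proof.
move=> iW mZ SZ S0 z.
have mW : measurable_fun [set: Omega] W.
  exact/measurable_EFinP/(measurable_int mu).
have mL t : measurable [set w | t <= Z w] by exact: measurable_superlevel.
have [Sz|nSz] := pselect (exists2 x, S x & z <= x); last first.
  rewrite (_ : [set w | _] = set0) ?Rintegral_set0// -subset0 => w /= zw.
  by apply: nSz; exists (Z w).
have [u [Su uz]] := threshold_approx _ _ _ Sz.
rewrite -Rintegral_mul_indic.
apply: (@dominated_Rintegral_ge0 _ _ _ mu
  (fun n w => W w * \1_[set w | u n <= Z w] w) _ (fun w => `|W w|)).
- by move=> n; apply: measurable_funM => //; exact: measurable_indic.
- by apply: measurable_funM => //; exact: measurable_indic.
(* Since [Z w] lies in [S], the indicators at [w] are eventually equal to their limit. *)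
- move=> w; apply: cvg_near_cst; have := uz _ (SZ w); apply: filterS => n un.
  rewrite !indicE; congr (_ * (nat_of_bool _)%:R).
  by apply/idP/idP => /set_mem /= ?; apply/mem_set => /=;
    [rewrite -un|rewrite un].
- exact: integrable_norm.
- move=> n w; rewrite normrM ler_piMr// indicE.
  by case: (_ \in _); rewrite ?normr0 ?normr1.
- by move=> n; rewrite Rintegral_mul_indic; exact: S0.
Qed.

(** With [Z] replaced by its staircase, the integral is a nonnegative combination of superlevel
    integrals of [W], plus a multiple of the zero integral of [W]; then the mesh tends to 0. *)
Lemma superlevel_correlation_ge0 (disp : measure_display)
    (Omega : measurableType disp) (R : realType)
    (mu : {measure set Omega -> \bar R}) (W Z : Omega -> R) (S : set R) :
  mu.-integrable [set: Omega] (EFin \o W) ->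
  \int[mu]_w W w = 0 ->
  measurable_fun [set: Omega] Z ->
  mu.-integrable [set: Omega] (EFin \o (fun w => W w * Z w)) ->
  (forall w, S (Z w)) ->
  (forall z, S z -> 0 <= \int[mu]_(w in [set w | z <= Z w]) W w) ->
  0 <= \int[mu]_w (W w * Z w).
Proof.
move=> iW W0 mZ iWZ SZ S0.
(* Grid points of the staircase need not lie in [S], so the sign is first extended to all real
   thresholds. *)
have {}S0 := superlevel_integral_ge0 _ _ _ _ _ _ _ iW mZ SZ S0.
have mW : measurable_fun [set: Omega] W.
  exact/measurable_EFinP/(measurable_int mu).
have mL t : measurable [set w | t <= Z w] by exact: measurable_superlevel.
have stE n w : W w * staircase R n (Z w) = n%:R^-1 *
  (\sum_(k < n * n.*2) W w * \1_[set w | k.+1%:R / n%:R - n%:R <= Z w] w)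
  - n%:R * W w.
  by rewrite /staircase -mulr_sumr; under [in RHS]eq_bigr do rewrite indicE; ring.
have mst n : measurable_fun [set: Omega] (fun w => W w * staircase R n.+1 (Z w)).
  under eq_fun do rewrite stE.
  apply: measurable_funB; apply: measurable_funM => //.
  by apply: measurable_sum => k; apply: measurable_funM => //; exact: measurable_indic.
apply: (@dominated_Rintegral_ge0 _ _ _ mu
  (fun n w => W w * staircase R n.+1 (Z w)) _ (fun w => `|W w * Z w| + `|W w|)).
- exact: mst.
- exact: measurable_funM.
- by move=> w; apply: cvgMr; exact: staircase_cvg.
- rewrite (_ : _ \o _ = (EFin \o (fun w => `|W w * Z w|%R)) \+
     (EFin \o (fun w => `|W w|%R)))%E//.
  by apply: integrableD => //; exact: integrable_norm.
- move=> n w; rewrite !normrM -[X in _ + X]mulr1 -mulrDr ler_wpM2l//; exact: staircase_norm_le.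
- move=> n; under eq_Rintegral do rewrite stE.
  have iL k : mu.-integrable [set: Omega] (EFin \o (fun w => W w *
       \1_[set w | k.+1%:R / n.+1%:R - n.+1%:R <= Z w] w)).
    exact: integrable_mul_indic.
  rewrite RintegralB// ?RintegralZl// ?W0 ?mulr0 ?subr0.
  - rewrite mulr_ge0// Rintegral_sum//; apply: sumr_ge0 => k _.
    by rewrite Rintegral_mul_indic; exact: S0.
  - exact: integrable_EFin_sum.
  - by apply: integrable_EFinZl; exact: integrable_EFin_sum.
  - exact: integrable_EFinZl.
Qed.

(** * Centering and degenerate events *)

Lemma covariance_centered (disp : measure_display)
    (Omega : measurableType disp) (R : realType)
    (P : probability Omega R) (X Z : Omega -> R) :
  P.-integrable [set: Omega] (EFin \o X) ->
  P.-integrable [set: Omega] (EFin \o Z) ->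
  P.-integrable [set: Omega] (EFin \o (fun w => X w * Z w)) ->
  covariance P X Z = (\int[P]_w ((X w - \int[P]_w X w) * Z w))%:E.
Proof.
move=> iX iZ iXZ.
rewrite covarianceE; [|exact/Lfun1_integrable..].
rewrite !expectation.unlock.
under [in RHS]eq_Rintegral do rewrite mulrBl.
rewrite RintegralB//; last exact: integrable_EFinZl.
by rewrite RintegralZl// EFinB EFinM /Rintegral !fineK//; exact: integrable_fin_num.
Qed.

(** A null event contributes nothing, and an event with null complement carries the whole integral,
    which is 0. This covers the thresholds excluded from the MTS-MIV condition. *)
Lemma Rintegral_degenerate (disp : measure_display)
    (Omega : measurableType disp) (R : realType)
    (P : probability Omega R) (W : Omega -> R) (A : set Omega) :
  measurable A -> P.-integrable [set: Omega] (EFin \o W) ->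
  \int[P]_w W w = 0 ->
  P A = 0%E \/ P (~` A) = 0%E -> \int[P]_(w in A) W w = 0.
Proof.
move=> mA iW W0.
have null B : measurable B -> P B = 0%E -> \int[P]_(w in B) W w = 0.
  move=> mB B0; rewrite /Rintegral null_set_integral//.
  by apply: measurable_int; exact: integrableS iW.
move=> [|C0]; first exact: null.
have mC := measurableC mA.
have := W0; rewrite -(setUv A) Rintegral_setU//.
- by rewrite (null (~` A))// addr0.
- by rewrite setUv.
- by apply/disj_setPS; rewrite setICr.
Qed.

Lemma integrable_centered (disp : measure_display)
    (Omega : measurableType disp) (R : realType)
    (P : probability Omega R) (X : Omega -> R) :
  P.-integrable [set: Omega] (EFin \o X) ->
  P.-integrable [set: Omega] (EFin \o (fun w => X w - \int[P]_w X w)).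
Proof.
move=> iX; set m := \int[P]_w X w.
have im := finite_measure_integrable_cst P m measurableT.
exact: (integrableB measurableT iX im).
Qed.

Lemma Rintegral_centered (disp : measure_display)
    (Omega : measurableType disp) (R : realType)
    (P : probability Omega R) (X : Omega -> R) :
  P.-integrable [set: Omega] (EFin \o X) ->
  \int[P]_w (X w - \int[P]_w X w) = 0.
Proof.
move=> iX; rewrite RintegralB//; last exact: finite_measure_integrable_cst.
by rewrite Rintegral_cst// [X in fine X](@probability_setT _ _ _ P) mulr1 subrr.
Qed.

(** If [A] or [B] is degenerate, one factor vanishes. Otherwise [cond_mean_sub] shows that the two
    products differ by a positive factor. *)
Lemma centered_integral_mul_ge0 (disp : measure_display)
    (Omega : measurableType disp) (R : realType)
    (P : probability Omega R) (X : Omega -> R) (A B : set Omega) :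
  P.-integrable [set: Omega] (EFin \o X) -> measurable A -> measurable B ->
  ((0 < P A)%E -> (0 < P (~` A))%E -> (0 < P B)%E -> (0 < P (~` B))%E ->
    0 <= (cond_mean P X A - cond_mean P X (~` A))
       * (cond_mean P X B - cond_mean P X (~` B))) ->
  0 <= (\int[P]_(w in A) (X w - \int[P]_w X w))
     * (\int[P]_(w in B) (X w - \int[P]_w X w)).
Proof.
move=> iX mA mB H.
have iW : P.-integrable [set: Omega] (EFin \o (fun w => X w - \int[P]_w X w)).
  exact: integrable_centered.
have W0 : \int[P]_w (X w - \int[P]_w X w) = 0.
  exact: Rintegral_centered.
have dichotomy E : measurable E ->
    ((0 < P E)%E /\ (0 < P (~` E))%E) \/
    \int[P]_(w in E) (X w - \int[P]_w X w) = 0.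
  move=> mE; have [E0|E0] := eqVneq (P E) 0%E.
    by right; apply: Rintegral_degenerate => //; left.
  have [C0|C0] := eqVneq (P (~` E)) 0%E.
    by right; apply: Rintegral_degenerate => //; right.
  by left; rewrite !lt0e E0 C0 !measure_ge0.
have [[A0 A1]|->] := dichotomy A mA; last by rewrite mul0r.
have [[B0 B1]|->] := dichotomy B mB; last by rewrite mulr0.
have f0 E : (0 < P E)%E -> measurable E -> 0 < fine (P E).
  by move=> E0 mE; rewrite fine_gt0// E0 ltey_eq fin_num_measure.
have q0 E : measurable E -> (0 < P E)%E -> (0 < P (~` E))%E ->
    0 < (fine (P E) * fine (P (~` E)))^-1.
  by move=> mE E0 E1; rewrite invr_gt0 mulr_gt0// f0//; exact: measurableC.
have := H A0 A1 B0 B1; rewrite !cond_mean_sub// mulrACA.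
by rewrite [X in is_true X -> _]pmulr_lge0// mulr_gt0// q0.
Qed.

(** * From the threshold condition to the covariances *)

Theorem lemma2p2 (disp : measure_display) (Omega : measurableType disp)
    (R : realType) (P : probability Omega R)
    (T : nat) (D : {dRV P >-> nat})
    (hD : forall w : Omega, (1 <= D w <= T)%N)
    (Y : nat -> {RV P >-> R})
    (hY : forall d : nat, (1 <= d <= T)%N ->
       P.-integrable [set: Omega] (fun w => (Y d w)%:E))
    (ZZ : set R) (Z : {RV P >-> R}) (hZZ : forall w : Omega, ZZ (Z w))
    (hZ : P.-integrable [set: Omega] (fun w => (Z w)%:E))
    (hYZ : forall d : nat, (1 <= d <= T)%N ->
       P.-integrable [set: Omega] (fun w => (Y d w * Z w)%:E)) :
  binarized_MTS_MIV P T D (fun d => Y d) ZZ Z ->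
  same_direction_of_correlation P T D (fun d => Y d) Z.
Proof.
move=> hMIV d dT; set X : Omega -> R := Y d.
pose N (w : Omega) : R := (D w)%:R.
have iX : P.-integrable [set: Omega] (EFin \o X) by exact: hY.
have iXZ : P.-integrable [set: Omega] (EFin \o (fun w => X w * Z w)).
  exact: hYZ.
have mZ : measurable_fun [set: Omega] Z by [].
have mN : measurable_fun [set: Omega] N.
  by apply: (measurableT_comp (f := fun n : nat => n%:R : R)).
(* The bound [D w <= T] yields the integrability of [N] and of [X * N]. *)
have bN : [bounded N w | w in [set: Omega]].
  exists T%:R; split; first exact: num_real.
  move=> M TM w _ /=; rewrite normr_nat (le_trans _ (ltW TM))// ler_nat.
  by have /andP[] := hD w.
have iXN : P.-integrable [set: Omega] (EFin \o (fun w => X w * N w)).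
  exact: integrableMl measurableT _ _ iX mN bN.
have iN : P.-integrable [set: Omega] (EFin \o N).
  exact: measurable_bounded_integrable (fin_num_fun_lty _) _ _.
rewrite (covariance_centered _ _ _ P X N)// (covariance_centered _ _ _ P X Z)//.
rewrite -EFinM lee_fin.
set W := fun w => X w - \int[P]_w X w.
have iW : P.-integrable [set: Omega] (EFin \o W).
  exact: integrable_centered.
have W0 : \int[P]_w W w = 0.
  exact: Rintegral_centered.
have iWM (V : Omega -> R) : P.-integrable [set: Omega] (EFin \o V) ->
    P.-integrable [set: Omega] (EFin \o (fun w => X w * V w)) ->
    P.-integrable [set: Omega] (EFin \o (fun w => W w * V w)).
  move=> iV iXV; have iEV := integrable_EFinZl _ _ _ _ (\int[P]_w X w) _ iV.
  apply: eq_integrable (integrableB measurableT iXV iEV) => // w _ /=.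
  by rewrite -EFinB mulrBl.
have iWr (r : R) (A : set Omega) : measurable A ->
    \int[P]_(w in A) (r * W w) = r * \int[P]_(w in A) W w.
  by move=> mA; rewrite RintegralZl//; exact: integrableS iW.
have rWV (r : R) (V : Omega -> R) :
    P.-integrable [set: Omega] (EFin \o (fun w => W w * V w)) ->
    P.-integrable [set: Omega] (EFin \o (fun w => r * W w * V w)) /\
    \int[P]_w (r * W w * V w) = r * \int[P]_w (W w * V w).
  move=> iWV; under eq_Rintegral do rewrite -mulrA.
  rewrite RintegralZl//; split => //.
  apply: eq_integrable (integrable_EFinZl _ _ _ _ r _ iWV) => // w _ /=.
  by rewrite mulrA.
have [iWN iWZ] := (iWM N iN iXN, iWM Z hZ iXZ).
have key z : ZZ z ->
    0 <= (\int[P]_(w in [set w | z <= Z w]) W w) * \int[P]_w (W w * N w).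
  move=> Zz; set r := \int[P]_(w in _) _.
  have [irWN <-] := rWV r N iWN.
  (* The constant [r] is absorbed into the weight, and the thresholds for [N] are restricted to 1,
     ..., [T], the range of [j] in [hMIV]. *)
  apply: (superlevel_correlation_ge0 _ _ _ P (fun w => r * W w) N
    [set x | exists2 j : nat, (1 <= j <= T)%N & x = j%:R]) => //.
  - exact: integrable_EFinZl.
  - by rewrite iWr// W0 mulr0.
  - by move=> w; exists (D w).
  - move=> _ [j jT ->]; rewrite iWr; last exact: measurable_superlevel.
    rewrite mulrC; apply: centered_integral_mul_ge0 => //;
      try exact: measurable_superlevel.
    rewrite (_ : [set w | _ <= N w] = [set w | (j <= D w)%N]); last first.
      by apply/seteqP; split => w /=; rewrite ler_nat.
    rewrite (_ : ~` [set w | (j <= D w)%N] = [set w | (D w < j)%N]); last first.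
      by apply/seteqP; split => w /=; rewrite ltnNge => /negP.
    rewrite (_ : ~` [set w | z <= Z w] = [set w | Z w < z]); last first.
      by apply/seteqP; split => w /=; rewrite ltNge => /negP.
    exact: hMIV.
(* The roles are exchanged: the integral of [W * N] is now the constant in the weight, and [key]
   gives the sign at each threshold in [ZZ]. *)
have [irWZ <-] := rWV (\int[P]_w (W w * N w)) Z iWZ.
apply: (superlevel_correlation_ge0 _ _ _ P (fun w => _ * W w) Z ZZ) => //.
- exact: integrable_EFinZl.
- by rewrite iWr// W0 mulr0.
- move=> z Zz; rewrite iWr; last exact: measurable_superlevel.
  by rewrite mulrC; exact: key.
Qed.
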